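(* Let $n\ge 5$ be an integer. If the wheel graph $W_n$ on $n$ vertices is geodesic Leech, then $n\le 40$.
   Context: Graphs are finite, simple, undirected and connected. A geodesic of a graph $G$ is a shortest path between two distinct vertices; a path and its reverse are regarded as the same, but distinct shortest paths with the same endpoints are counted separately. Let $t_{gp}(G)$ be the number of geodesics of $G$. For an edge labeling $f:E(G)\to\{1,2,3,\ldots\}$, the weight of a path is the sum of the labels of its edges. The labeling $f$ is a geodesic Leech labeling if the multiset of the weights of all geodesics of $G$ is exactly $\{1,2,\ldots,t_{gp}(G)\}$, each value occurring once. A graph is geodesic Leech if it admits a geodesic Leech labeling. $W_n$ denotes the wheel on $n$ vertices: a hub joined to every vertex of a cycle of length $n-1$. *)

(* Defs.v *)
From mathcomp Require Import all_boot.

Set Implicit Arguments.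
Unset Strict Implicit.
Unset Printing Implicit Defensive.

(** A finite simple graph is a symmetric irreflexive relation on a [finType];
    its edges are unordered pairs of vertices. *)

Section Geodesics.

Variables (T : finType) (e : rel T).

Definition edges : {set {set T}} :=
  [set [set u.1; u.2] | u : T * T & e u.1 u.2].

Definition simple_path (x : T) (p : seq T) : bool :=
  path e x p && uniq (x :: p).

(** Bounding the competitors [q] by length [#|T|] only serves to make the
    definition boolean, see [geodesicP]. *)
Definition geodesic (x : T) (p : seq T) : bool :=
  [&& simple_path x p, x != last x p &
    [forall q : #|T|.-bseq T,
       simple_path x q && (last x q == last x p) ==> (size p <= size q)]].

Definition path_edges (x : T) (p : seq T) : {set {set T}} :=
  [set [set u.1; u.2] | u in zip (x :: p) p].

(** Representing a path by its edge set identifies it with its reverse and with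
    no other path (at least one edge is present, since the endpoints differ). *)
Definition geodesics : {set {set {set T}}} :=
  [set path_edges xp.1 xp.2 | xp : T * #|T|.-bseq T & geodesic xp.1 xp.2].

Definition t_gp : nat := #|geodesics|.

(** Only the values of the labeling [f] on [edges] are relevant. *)
Definition weight (f : {set T} -> nat) (P : {set {set T}}) : nat :=
  \sum_(a in P) f a.

Definition geodesic_Leech_labeling (f : {set T} -> nat) : Prop :=
  {in edges, forall a, 0 < f a} /\
  perm_eq [seq weight f P | P <- enum geodesics] (iota 1 t_gp).

Definition geodesic_Leech : Prop :=
  exists f : {set T} -> nat, geodesic_Leech_labeling f.

Lemma simple_path_size x p : simple_path x p -> size p <= #|T|.
Proof.
case/andP=> _ /card_uniqP xp.
by apply: ltnW; rewrite -[_.+1]xp max_card.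
Qed.

Lemma geodesicP x p :
  reflect [/\ simple_path x p, x != last x p &
            forall q, simple_path x q -> last x q = last x p ->
              size p <= size q]
          (geodesic x p).
Proof.
apply: (iffP and3P) => -[sp xp H]; split=> //.
  move=> q sq lq; move/forallP: H => /(_ (Bseq (simple_path_size sq))) /=.
  by rewrite sq lq eqxx.
by apply/forallP=> q; apply/implyP=> /andP[sq /eqP lq]; apply: H.
Qed.

Lemma geodesicsP P :
  reflect (exists x p, geodesic x p /\ P = path_edges x p) (P \in geodesics).
Proof.
apply: (iffP imsetP) => [[[x p] /=] | [x [p [gp ->]]]].
  by rewrite inE /= => gp ->; exists x, p.
have /geodesicP[sp _ _] := gp.
by exists (x, Bseq (simple_path_size sp)); rewrite ?inE.
Qed.

End Geodesics.

(** The wheel on [n] vertices: the hub is [None], and the rim is the cycle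
    [0, 1, ..., n.-2]. This is a simple graph only for [n >= 3], and its rim is
    a genuine cycle only for [n >= 4]. *)
Definition wheel (n : nat) : rel (option 'I_n.-1) := fun u v =>
  match u, v with
  | None, None => false
  | Some i, Some j => (j == ordS i) || (i == ordS j)
  | _, _ => true
  end.

Lemma card_wheel n : 0 < n -> #|{: option 'I_n.-1}| = n.
Proof. by move=> n0; rewrite card_option card_ord prednK. Qed.

Lemma wheel_sym n : symmetric (@wheel n).
Proof. by case=> [i|] [j|] //=; rewrite orbC. Qed.

Lemma wheel_irrefl n : 2 < n -> irreflexive (@wheel n).
Proof.
case: n => [|[|[|n]]] // _ [i|] //=; rewrite orbb; apply/eqP=> /(congr1 val) /=.
have := ltn_ord i; rewrite /= leq_eqVlt => /orP[/eqP [i1]|lt].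
  by rewrite i1 modnn.
by rewrite modn_small // => /n_Sn.
Qed.

Lemma wheel_connected n (u v : option 'I_n.-1) : connect (@wheel n) u v.
Proof.
apply: (@connect_trans _ _ None).
  by case: u => [i|]; [apply: connect1 | apply: connect0].
by case: v => [i|]; [apply: connect1 | apply: connect0].
Qed.

(* Main.v *)
Require Import Defs.
From mathcomp Require Import all_boot.
From mathcomp Require Import all_order all_algebra zify ring lra.
From mathcomp Require Import Rstruct reals topology normedtype derive trigo.

(* Put m = n - 1 and give the hub the label 0. Spokes and two-edge paths through
   the hub are then the pairs of distinct vertices that are not adjacent on the
   rim, the weight of such a path being the sum of the two labels. These sums
   are distinct and take all but 2m of the values 1, ..., T = m(m+3)/2. Hence,
   if z(th) is the sum of exp(i th (g x - (T+1)/4)) over all vertices x with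
   label g x, then z(th)^2 differs by at most about 6m from twice the Dirichlet
   kernel of {1, ..., T}, which is real. At frequencies th where this kernel is
   as negative as a multiple of -T, the real part of z(th) has to be bounded.
   But a combination of three such real parts is at least the number of labels
   up to T/2, because the corresponding combination of cosines is at least 1
   there. All but at most two labels are that small. If one of them exceeds T/2
   by more than 3m/2, most of the others are below T/2 - 3m/2, and the argument
   applies to these with T - 3m instead of T. *)

Set Implicit Arguments.
Unset Strict Implicit.
Unset Printing Implicit Defensive.
Import Order.TTheory GRing.Theory Num.Theory numFieldNormedType.Exports.

(** * Sums over pairs of labels *)

Section PairSums.
Variables (I : finType) (J : {set I}) (adj : rel I) (g : I -> nat) (T : nat).
Local Open Scope ring_scope.

Definition far_pairs : {set I * I} :=
  [set u in setX J J | (u.1 != u.2) && ~~ adj u.1 u.2].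
Definition near_pairs : {set I * I} :=
  [set u in setX J J | (u.1 != u.2) && adj u.1 u.2].

Hypothesis far_range : forall u, u \in far_pairs -> (0 < g u.1 + g u.2 <= T)%N.
Hypothesis far_inj : {in far_pairs &, forall u v,
  (g u.1 + g u.2 = g v.1 + g v.2)%N -> v = u \/ v = (u.2, u.1)}.

Lemma card_pairs : (#|J| ^ 2 = #|J| + #|near_pairs| + #|far_pairs|)%N.
Proof.
have e : setX J J = [set (x, x) | x in J] :|: near_pairs :|: far_pairs.
  apply/setP=> -[x y]; rewrite !inE /=; apply/idP/idP.
    move=> /andP[xJ yJ]; rewrite xJ yJ /=; case: (eqVneq x y) => [<-|_] /=.
      by rewrite orbF; apply/orP; left; apply/imsetP; exists x.
    by case: (adj x y); rewrite ?orbT.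
  case/orP=> [/orP[/imsetP[z zJ [-> ->]]|]|]; first by rewrite zJ.
    by case/andP.
  by case/andP.
have d1 : [disjoint [set (x, x) | x in J] & near_pairs].
  rewrite -setI_eq0; apply/eqP/setP=> u; rewrite inE [RHS]inE; apply/negP.
  by case/andP=> /imsetP[z _ ->]; rewrite !inE /= eqxx !andbF.
have d2 : [disjoint [set (x, x) | x in J] :|: near_pairs & far_pairs].
  rewrite -setI_eq0; apply/eqP/setP=> u; rewrite inE [RHS]inE; apply/negP.
  rewrite in_setU => /andP[/orP[/imsetP[z _ ->]|]]; first by rewrite !inE /= eqxx !andbF.
  by rewrite !inE => /and3P[_ _ ->]; rewrite !andbF.
have := congr1 (fun A : {set I * I} => #|A|) e; rewrite cardsX mulnn => ->.
rewrite !cardsU (disjoint_setI0 d2) (disjoint_setI0 d1) !cards0 !subn0.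
by rewrite card_imset // => x y [].
Qed.

Variables (R : realDomainType) (H : nat -> R) (r : R).
Hypothesis H_le : forall w, `|H w| <= r.

Let mult w := #|[set u in far_pairs | (g u.1 + g u.2 == w)%N]|.

(** By [far_inj], two far pairs with the same sum are equal or swaps of each other. *)
Lemma mult_le2 w : (mult w <= 2)%N.
Proof.
rewrite /mult; case: (set_0Vmem [set u in far_pairs | (g u.1 + g u.2 == w)%N]).
  by move=> ->; rewrite cards0.
case=> u; rewrite inE => /andP[uF /eqP uw].
apply: (@leq_trans #|[set u; (u.2, u.1)]|); last by rewrite cards2; case: (_ == _).
apply/subset_leq_card/subsetP=> v; rewrite inE => /andP[vF /eqP vw].
by rewrite !inE; case: (far_inj uF vF (etrans uw (esym vw))) => ->; rewrite eqxx ?orbT.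
Qed.

Lemma sum_far (F : nat -> R) :
  \sum_(u in far_pairs) F (g u.1 + g u.2)%N
  = \sum_(1 <= w < T.+1) (mult w)%:R * F w.
Proof.
transitivity (\sum_(u in far_pairs) \sum_(1 <= w < T.+1)
    (if (g u.1 + g u.2 == w)%N then F w else 0)).
  apply: eq_bigr => u /far_range uT; rewrite -big_mkcond /=.
  rewrite (eq_bigl (fun w => w == (g u.1 + g u.2)%N)) => [|w]; last by rewrite eq_sym.
  by rewrite big_nat1_eq ltnS uT.
rewrite exchange_big; apply: eq_bigr => w _.
rewrite -big_mkcondr /= -(eq_bigl _ _ (fun u => in_set _ _)) sumr_const mulr_natl.
by congr (_ *+ _); apply: eq_card => u; rewrite !inE.
Qed.

(** Replacing the multiplicity of every [w] by 2 costs at most [2 T - #|far_pairs|] times [r], and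
    each near pair costs [r]; [card_pairs] then eliminates [#|far_pairs|]. The diagonal is kept
    apart because for exponentials it is a sum over single labels at the doubled frequency. *)
Lemma sum_pairs_deviation :
  `|\sum_(x in J) \sum_(y in J) H (g x + g y)%N
    - 2 * \sum_(1 <= w < T.+1) H w - \sum_(x in J) H (g x + g x)%N|
  <= (2 * T%:R - #|J|%:R * (#|J|%:R - 1) + 2 * #|near_pairs|%:R) * r.
Proof.
have r0 : 0 <= r by apply: le_trans (H_le 0).
have split : \sum_(x in J) \sum_(y in J) H (g x + g y)%N
    = \sum_(x in J) H (g x + g x)%N + \sum_(u in near_pairs) H (g u.1 + g u.2)%N
      + \sum_(u in far_pairs) H (g u.1 + g u.2)%N.
  rewrite pair_big /= (bigID (fun u : I * I => u.1 == u.2)) /=.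
  rewrite -addrA; congr (_ + _).
    rewrite [RHS](eq_bigr (fun x => \sum_(y in J | x == y) H (g x + g y)%N)).
      by rewrite pair_big_dep /=; apply: eq_bigl => u; rewrite andbA.
    move=> x xJ; rewrite (big_pred1 x) // => y /=.
    by rewrite eq_sym; case: eqVneq => [->|]; rewrite ?xJ ?andbF.
  rewrite (bigID (fun u : I * I => adj u.1 u.2)) /=; congr (_ + _).
    by apply: eq_bigl => u; rewrite !inE !andbA.
  by apply: eq_bigl => u; rewrite !inE !andbA.
have near : `|\sum_(u in near_pairs) H (g u.1 + g u.2)%N| <= #|near_pairs|%:R * r.
  apply: le_trans (ler_norm_sum _ _ _) _.
  by rewrite mulr_natl -sumr_const; apply: ler_sum.
have far : `|\sum_(u in far_pairs) H (g u.1 + g u.2)%N - 2 * \sum_(1 <= w < T.+1) H w|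
    <= (2 * T%:R - #|far_pairs|%:R) * r.
  rewrite sum_far mulr_sumr -sumrB.
  apply: le_trans (ler_norm_sum _ _ _) _.
  apply: (@le_trans _ _ (\sum_(1 <= w < T.+1) (2 - (mult w)%:R) * r)).
    apply: ler_sum => w _.
    have m2 : 0 <= 2 - (mult w)%:R :> R by rewrite subr_ge0 ler_nat mult_le2.
    by rewrite -mulrBl normrM distrC (ger0_norm m2) ler_wpM2l.
  rewrite -mulr_suml; apply: ler_wpM2r => //; rewrite sumrB.
  rewrite big_const_nat subn1 /= iter_addr_0 -(mulr_natr 2); apply: lerB => //.
  (* The multiplicities add up to the number of far pairs. *)
  have := sum_far (fun=> 1); rewrite sumr_const => ->.
  by apply: ler_sum => w _; rewrite mulr1.
have cp : #|J|%:R ^+ 2 = #|J|%:R + #|near_pairs|%:R + #|far_pairs|%:R :> R.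
  by rewrite -natrX card_pairs !natrD.
rewrite split {split}; move: near far.
set d := \sum_(x in J) _; set n := \sum_(u in near_pairs) _.
set f := \sum_(u in far_pairs) _; set h := \sum_(_ <= _ < _) _ => near far.
have -> : d + n + f - 2 * h - d = n + (f - 2 * h) by ring.
apply: le_trans (ler_normD _ _) _; apply: le_trans (lerD near far) _.
rewrite -mulrDl; apply: ler_wpM2r => //; move: cp; lra.
Qed.

End PairSums.

(** * Geodesics of the wheel *)

Section ShortGeodesics.
Variables (T : finType) (e : rel T).

Lemma path_edges1 (x y : T) : path_edges x [:: y] = [set [set x; y]].
Proof.
rewrite /path_edges /=; apply/setP=> a; rewrite inE; apply/imsetP/eqP.
  by case=> u; rewrite inE => /eqP-> ->.
by move->; exists (x, y); rewrite ?inE.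
Qed.

Lemma path_edges2 (x z y : T) :
  path_edges x [:: z; y] = [set [set x; z]; [set z; y]].
Proof.
rewrite /path_edges /=; apply/setP=> a; rewrite !inE; apply/imsetP/orP.
  by case=> u; rewrite !inE => /orP[] /eqP-> ->; [left|right].
by case=> /eqP->; [exists (x, z) | exists (z, y)]; rewrite ?inE ?eqxx ?orbT.
Qed.

Lemma geodesic_edge x y : x != y -> e x y -> geodesic e x [:: y].
Proof.
move=> xy exy; apply/geodesicP; split=> //=.
  by rewrite /simple_path /= exy inE xy.
by case=> [|z q] //= _ xE; rewrite xE eqxx in xy.
Qed.

Lemma geodesic_step2 x z y : x != y -> ~~ e x y -> e x z -> e z y ->
  geodesic e x [:: z; y].
Proof.
move=> xy nxy exz ezy; apply/geodesicP; split=> //=.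
  rewrite /simple_path /= exz ezy !inE negb_or xy !andbT.
  by rewrite /=; apply/andP; split; [apply: contraNneq nxy => -> | apply: contraNneq nxy => <-].
case=> [|w [|w' q]] //=; first by move=> _ xE; rewrite xE eqxx in xy.
by rewrite /simple_path /= andbT => /andP[exw _] wy; rewrite -wy exw in nxy.
Qed.

End ShortGeodesics.

Lemma val_iter_ordS m (j : 'I_m) k : val (iter k (@ordS m) j) = (j + k) %% m.
Proof.
elim: k => [|k IHk] /=; first by rewrite addn0 modn_small.
by rewrite IHk -addn1 modnDml addn1 addnS.
Qed.

Lemma iter_ordS_eq m (j : 'I_m) k l : k < m -> l < m ->
  (iter k (@ordS m) j == iter l (@ordS m) j) = (k == l).
Proof.
move=> km lm; rewrite -val_eqE !val_iter_ordS eqn_modDl !modn_small //.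
Qed.

Definition rim_adj {m} : rel (option 'I_m) := fun u v =>
  if (u, v) is (Some i, Some j) then (j == ordS i) || (i == ordS j) else false.

Section Wheel.
Variable m : nat.
Hypothesis m_ge5 : 5 <= m.
Notation V := (option 'I_m).
Notation W := (@wheel m.+1).
Notation rimS := (@ordS m).

Definition spoke_label (f : {set V} -> nat) (x : V) : nat :=
  if x is Some _ then f [set None; x] else 0.

(* Adding the hub to the spokes as a vertex of label 0 that is not adjacent to
   the rim makes spokes and two-edge paths through the hub the same thing. *)
Definition hub_path (x y : V) : {set {set V}} :=
  [set [set None; z] | z in [set x; y] :\ None].

Lemma mem_hub_path x y z : z != None ->
  ([set None; z] \in hub_path x y) = (z == x) || (z == y).
Proof.
move=> z0; apply/imsetP/idP.
  case=> w; rewrite !inE => /andP[w0 wxy] /setP/(_ z).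
  by rewrite !inE eqxx (negPf z0) /= => /esym/eqP ->.
by move=> zxy; exists z; rewrite // !inE z0.
Qed.

(** The spokes of a hub path show which rim vertices are among its ends; a single spoke means that
    the other end is the hub. *)
Lemma hub_path_inj x y x' y' : x != y -> x' != y' ->
  hub_path x y = hub_path x' y' -> (x', y') = (x, y) \/ (x', y') = (y, x).
Proof.
move=> xy xy' e.
have H z : z != None -> (z == x) || (z == y) = (z == x') || (z == y').
  by move=> z0; rewrite -!mem_hub_path // e.
case: x y x' y' xy xy' H {e} => [a|] [b|] [c|] [d|] // xy xy' H.
- have := H (Some c) isT; rewrite eqxx /= => /orP[]/eqP ce;
    have := H (Some d) isT; rewrite eqxx orbT => /orP[]/eqP de.
  + by rewrite ce de eqxx in xy'.
  + by left; rewrite ce de.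
  + by right; rewrite ce de.
  + by rewrite ce de eqxx in xy'.
- have := H (Some a) isT; have := H (Some b) isT; rewrite !eqxx !orbF orbT /=.
  by move=> /esym/eqP be /esym/eqP ae; rewrite ae be eqxx in xy.
- have := H (Some a) isT; have := H (Some b) isT; rewrite !eqxx orbT /=.
  by move=> /esym/eqP be /esym/eqP ae; rewrite ae be eqxx in xy.
- have := H (Some c) isT; have := H (Some d) isT; rewrite !eqxx !orbF orbT /=.
  by move=> /eqP be /eqP ae; rewrite ae be eqxx in xy'.
- by have := H (Some a) isT; rewrite eqxx /= orbF => /esym/eqP ->; left.
- by have := H (Some a) isT; rewrite eqxx /= => /esym/eqP ->; right.
- have := H (Some c) isT; have := H (Some d) isT; rewrite !eqxx orbT /=.
  by move=> /eqP be /eqP ae; rewrite ae be eqxx in xy'.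
- by have := H (Some b) isT; rewrite eqxx /= orbF => /esym/eqP ->; right.
- by have := H (Some b) isT; rewrite eqxx /= => /esym/eqP ->; left.
Qed.

(** The hub contributes no spoke, which agrees with its label 0. *)
Lemma weight_hub_path f x y : x != y ->
  weight f (hub_path x y) = spoke_label f x + spoke_label f y.
Proof.
move=> xy; rewrite /weight big_imset /=; last first.
  move=> u v; rewrite !inE => /andP[u0 _] _ /setP/(_ u).
  by rewrite !inE eqxx (negPf u0) /= => /esym/eqP.
transitivity (\sum_(z in [set x; y]) spoke_label f z).
  rewrite [RHS](bigID (fun z => z == None)) /= [X in X + _]big1 ?add0n.
    apply: eq_big => [z|[z|]]; rewrite !inE ?eqxx //; exact: andbC.
  by move=> z /andP[_ /eqP->].
by rewrite big_setU1 ?inE //= big_set1.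
Qed.

Lemma geodesic_hub_path x y : x != y -> ~~ rim_adj x y -> hub_path x y \in geodesics W.
Proof.
move=> xy nr; apply/geodesicsP.
case: x y xy nr => [i|] [j|] // xy nr.
- exists (Some i), [:: None; Some j]; split; first exact: geodesic_step2.
  rewrite path_edges2; apply/setP=> a; rewrite !inE; apply/imsetP/orP.
    case=> z; rewrite !inE => /andP[_ /orP[]/eqP->] ->; last by right.
    by left; rewrite setUC.
  case=> /eqP->; [exists (Some i) | exists (Some j)]; rewrite ?inE ?eqxx ?orbT //.
  exact: setUC.
- exists None, [:: Some i]; split; first exact: geodesic_edge.
  rewrite path_edges1; apply/setP=> a; rewrite !inE; apply/imsetP/eqP.
    by case=> z; rewrite !inE => /andP[z0 /orP[]/eqP zE] ->; rewrite zE // zE in z0 *.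
  by move->; exists (Some i); rewrite ?inE ?eqxx.
- exists None, [:: Some j]; split; first exact: geodesic_edge.
  rewrite path_edges1; apply/setP=> a; rewrite !inE; apply/imsetP/eqP.
    by case=> z; rewrite !inE => /andP[z0 /orP[]/eqP zE] ->; rewrite zE // zE in z0 *.
  by move->; exists (Some j); rewrite ?inE ?eqxx ?orbT.
Qed.

Definition rim_edge (i : 'I_m) : {set V} := [set Some i; Some (rimS i)].

(** Any two vertices are adjacent or joined through the hub, so a geodesic has at most two edges. If
    it has two, its middle vertex is the hub or the common rim neighbour of its ends. *)
Lemma geodesic_classification P : P \in geodesics W ->
  [\/ exists x y, [/\ x != y, ~~ rim_adj x y & P = hub_path x y],
      exists i, P = [set rim_edge i] |
      exists i, P = [set rim_edge i; rim_edge (rimS i)]].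
Proof.
have hub_spoke (j : 'I_m) : hub_path None (Some j) = [set [set None; Some j]].
  apply/setP=> a; rewrite !inE; apply/imsetP/eqP.
    by case=> z; rewrite !inE => /andP[z0 /orP[]/eqP zE] ->; rewrite zE // zE in z0 *.
  by move->; exists (Some j); rewrite ?inE ?eqxx ?orbT.
case/geodesicsP=> x [p [/geodesicP[sp xp minp] ->]].
case: p sp xp minp => [|y p]; first by rewrite /= eqxx.
case: p => [|y' [|y'' p]].
- move=> /=; rewrite /simple_path /= !andbT => /andP[exy _] xy _.
  rewrite path_edges1; case: x y exy xy => [i|] [j|] //= exy xy.
  + case/orP: exy => /eqP ->; constructor 2; first by exists i.
    by exists j; rewrite /rim_edge setUC.
  + by constructor 1; exists None, (Some i); rewrite hub_spoke setUC.
  + by constructor 1; exists None, (Some j); rewrite hub_spoke.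
- rewrite path_edges2 /= => /andP[/= /and3P[exz ezy _] _] xy minp.
  have nxy : ~~ W x y'.
    apply/negP=> exy; have := minp [:: y'].
    by rewrite /simple_path /= exy inE xy => /(_ isT erefl).
  case: x y' exz ezy xy nxy {minp} => [i|] [k|] //=; case: y => [j|] //=.
  + move=> ij jk ik nik; constructor 3.
    case/orP: ij => /eqP ji; case/orP: jk => /eqP kj.
    * by exists i; rewrite kj ji.
    * by move: ik; rewrite ji in kj; rewrite (ordS_inj kj) eqxx.
    * by rewrite ji kj eqxx in ik.
    * by exists k; rewrite /rim_edge ji kj [LHS]setUC; congr [set _; _]; rewrite setUC.
  + move=> _ _ ik nik; constructor 1; exists (Some i), (Some k); split=> //.
    apply/setP=> a; rewrite !inE; apply/orP/imsetP.
      case=> /eqP->; [exists (Some i) | exists (Some k)]; rewrite ?inE ?eqxx ?orbT //.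
      exact: setUC.
    case=> z; rewrite !inE => /andP[_ /orP[]/eqP->] ->; last by right.
    by left; rewrite setUC.
- move=> _ xy minp; exfalso; move: xy minp.
  set z := last _ _ => xy minp.
  have [exz|nxz] := boolP (W x z).
    by have := minp [:: z]; rewrite /simple_path /= exz inE xy => /(_ isT erefl).
  have : simple_path W x [:: None; z].
    by case: x z xy nxz {minp} => [i|] [k|] //= ik _; rewrite /simple_path /= !inE ik.
  by move=> /minp/(_ erefl).
Qed.

Lemma rimS_neq i : rimS i != i.
Proof. by rewrite (@iter_ordS_eq m i 1 0) //; lia. Qed.

Lemma rimSS_neq i : rimS (rimS i) != i.
Proof. by rewrite (@iter_ordS_eq m i 2 0) //; lia. Qed.

Definition arcs (A : {set 'I_m}) : {set V * V} :=
  [set (Some i, Some (rimS i)) | i in A] :|: [set (Some (rimS i), Some i) | i in A].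

(** The two orientations are disjoint, as two steps along the rim do not lead back. *)
Lemma card_arcs (A : {set 'I_m}) : #|arcs A| = 2 * #|A|.
Proof.
rewrite cardsU !card_imset; try by move=> i j [].
rewrite disjoint_setI0 ?cards0; first by rewrite subn0 addnn mul2n.
rewrite -setI_eq0; apply/eqP/setP=> u; rewrite !inE; apply/negP.
case/andP=> /imsetP[i _ ->] /imsetP[j _ [ij ji]].
by have := rimSS_neq i; rewrite ji -ij eqxx.
Qed.

Lemma near_pairs_arcs (J : {set V}) :
  near_pairs J rim_adj = arcs [set i | (Some i \in J) && (Some (rimS i) \in J)].
Proof.
apply/setP=> -[[i|] [j|]]; last first.
- by rewrite !inE /= !andbF; apply/esym/negP=> /orP[]/imsetP[].
- by rewrite !inE /= !andbF; apply/esym/negP=> /orP[]/imsetP[].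
- by rewrite !inE /= !andbF; apply/esym/negP=> /orP[]/imsetP[].
rewrite !inE /=; apply/idP/orP.
  case/and3P=> /andP[iJ jJ] _ /orP[]/eqP e; [left|right]; apply/imsetP.
    by exists i; rewrite ?inE -?e ?iJ.
  by exists j; rewrite ?inE -?e ?iJ ?jJ.
case=> /imsetP[k]; rewrite inE => /andP[kJ kJ'] [-> ->];
    apply/and3P; split; rewrite ?kJ ?kJ' // /rim_adj ?eqxx ?orbT //.
  by rewrite eq_sym; exact: rimS_neq.
exact: rimS_neq.
Qed.

Lemma card_near_pairsT : #|near_pairs [set: V] rim_adj| = 2 * m.
Proof.
rewrite near_pairs_arcs card_arcs; congr (2 * _).
by rewrite -[RHS]card_ord; apply: eq_card => i; rewrite !inE.
Qed.

Lemma card_far_pairsT : #|far_pairs [set: V] rim_adj| = m * m - m.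
Proof.
have := card_pairs [set: V] rim_adj.
by rewrite card_near_pairsT cardsT card_option card_ord; nia.
Qed.

(** There are at most [m (m - 1) / 2] hub paths, [m] rim edges and [m] pairs of consecutive rim
    edges. *)
Lemma t_gp_le : 2 * t_gp W <= m * (m + 3).
Proof.
pose hubs := [set hub_path u.1 u.2 | u in far_pairs [set: V] rim_adj].
have sub : geodesics W \subset
    hubs :|: [set [set rim_edge i] | i in 'I_m]
    :|: [set [set rim_edge i; rim_edge (rimS i)] | i in 'I_m].
  apply/subsetP=> P /geodesic_classification; rewrite !inE.
  case=> [[x [y [xy nr ->]]]|[i ->]|[i ->]].
  - by rewrite (_ : hub_path x y \in hubs) //; apply/imsetP; exists (x, y); rewrite ?inE /= ?xy.
  - by rewrite [X in _ || X || _]imset_f ?orbT.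
  - by rewrite [X in _ || X]imset_f ?orbT.
(* Each hub path arises from both orders of a far pair. *)
have hubs2 : #|hubs| * 2 <= m * m - m.
  rewrite -card_far_pairsT -[X in _ <= X]sum1_card.
  rewrite (partition_big_imset (fun u => hub_path u.1 u.2)) /=.
  rewrite -sum_nat_const; apply: leq_sum => P /imsetP[u uF ->].
  rewrite sum1_card; apply: leq_trans (_ : #|[set u; (u.2, u.1)]| <= _).
    move: uF; rewrite cards2 !inE; case: u => x y /= /andP[xy _].
    by rewrite xpair_eqE (negPf xy).
  apply/subset_leq_card/subsetP=> v; case/set2P=> -> /=.
    by rewrite unfold_in /= uF eqxx.
  rewrite unfold_in /= {2}/hub_path setUC eqxx andbT.
  move: uF; rewrite !inE eq_sym => /andP[-> ] /=.
  by rewrite /rim_adj; case: u => -[i|] [j|] //=; rewrite orbC.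
apply: leq_trans (leq_mul (leqnn 2) (subset_leq_card sub)) _.
set B := [set [set rim_edge i] | i in 'I_m].
set C := [set [set rim_edge i; rim_edge (rimS i)] | i in 'I_m].
have BC : #|hubs :|: B :|: C| <= #|hubs| + #|B| + #|C|.
  by apply: leq_trans (leq_card_setU _ _) _; rewrite leq_add2r leq_card_setU.
have Bm : #|B| <= m by rewrite -[X in _ <= X]card_ord leq_imset_card.
have Cm : #|C| <= m by rewrite -[X in _ <= X]card_ord leq_imset_card.
move: hubs2 BC Bm Cm; set h := #|_|; set b := #|B|; set c := #|C|; set k := #|_|; nia.
Qed.

(** * Hub paths under a geodesic Leech labeling *)

Section Labels.
Variable f : {set V} -> nat.
Hypothesis hf : geodesic_Leech_labeling W f.
Let g := spoke_label f.

Lemma far_label_range u : u \in far_pairs [set: V] rim_adj ->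
  0 < g u.1 + g u.2 <= t_gp W.
Proof.
rewrite !inE /= => /andP[xy nr]; rewrite -weight_hub_path //.
have : weight f (hub_path u.1 u.2) \in [seq weight f P | P <- enum (geodesics W)].
  by rewrite map_f // mem_enum geodesic_hub_path.
by rewrite (perm_mem hf.2) mem_iota add1n ltnS.
Qed.

Lemma far_label_inj : {in far_pairs [set: V] rim_adj &, forall u v,
  g u.1 + g u.2 = g v.1 + g v.2 -> v = u \/ v = (u.2, u.1)}.
Proof.
move=> u v; rewrite !inE /= => /andP[xy nr] /andP[xy' nr'].
rewrite -!weight_hub_path // => e.
have winj : {in geodesics W &, injective (weight f)}.
  by apply/dinjectiveP; rewrite /dinjectiveb (perm_uniq hf.2) iota_uniq.
have := winj _ _ (geodesic_hub_path xy nr) (geodesic_hub_path xy' nr') e.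
by move/(hub_path_inj xy xy'); rewrite -!surjective_pairing.
Qed.

End Labels.
End Wheel.

(** * Numerical bounds for sine and cosine *)

Section TrigBounds.
Variable R : realType.
Local Open Scope ring_scope.
Implicit Types x y : R.

Lemma sin_le x : 0 <= x -> sin x <= x.
Proof.
move=> x0.
have [|c _] := @MVT_segment R sin cos 0 x x0 (fun y _ => is_derive_sin y).
  by apply/continuous_subspaceT => y; exact: continuous_sin.
by rewrite sin0 !subr0 => ->; rewrite ler_piMl// cos_le1.
Qed.

Lemma cos_double x : cos (2 * x) = 2 * cos x ^+ 2 - 1.
Proof. by rewrite mulr_natl cos_mulr2n mulr_natl. Qed.

Lemma cos_half_sin x : cos x = 1 - 2 * sin (x / 2) ^+ 2.
Proof.
rewrite -[in LHS](_ : 2 * (x / 2) = x); last by field.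
rewrite cos_double sin2cos2; ring.
Qed.

Lemma cos_ge_quadratic x : 0 <= x <= pi -> 1 - x ^+ 2 / 2 <= cos x.
Proof.
move=> /andP[x0 xpi]; rewrite cos_half_sin.
have h : sin (x / 2) <= x / 2 by apply: sin_le; lra.
have h0 : 0 <= sin (x / 2) by apply: sin_ge0_pi; lra.
nra.
Qed.

(** The derivative of [sin y + y ^+ 3 / 6] is at least 1 by [cos_ge_quadratic]. *)
Lemma sin_ge_cubic x : 0 <= x <= pi -> x - x ^+ 3 / 6 <= sin x.
Proof.
move=> /andP[x0 xpi].
pose f (y : R) := sin y + y ^+ 3 / 6.
have df y : is_derive y 1 f (cos y + y ^+ 2 / 2).
  by apply: (@is_derive_eq _ _ _ f); rewrite /GRing.scale /=; field.
have fc : continuous f.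
  by move=> y; apply/differentiable_continuous/derivable1_diffP/ex_derive.
have [|c cx] := @MVT_segment R f _ 0 x x0 (fun y _ => df y).
  exact/continuous_subspaceT.
rewrite /f sin0 expr0n /= mul0r !subr0 addr0 => e.
have /andP[c0 cx'] : 0 <= c <= x by rewrite !(itvP cx).
have h : 1 - c ^+ 2 / 2 <= cos c by apply: cos_ge_quadratic; lra.
have : x <= (cos c + c ^+ 2 / 2) * x by rewrite ler_peMl//; lra.
by rewrite -e; lra.
Qed.

Lemma cos_triple x : cos (3 * x) = 4 * cos x ^+ 3 - 3 * cos x.
Proof.
rewrite (_ : 3 * x = 2 * x + x); last by ring.
rewrite cosD cos_double (_ : 2 * x = x + x); last by ring.
rewrite sinD; have := sin2cos2 x; set s := sin x; set c := cos x => h.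
have -> : (2 * c ^+ 2 - 1) * c - (s * c + c * s) * s
  = (2 * c ^+ 2 - 1) * c - 2 * c * s ^+ 2 by ring.
by rewrite h; ring.
Qed.

(** By [cos_triple], this cosine is a positive root of [4 c ^+ 3 - 3 c + 1], which factors. *)
Lemma cos_pi3 : cos (pi / 3) = 1 / 2 :> R.
Proof.
have p0 := pi_gt0 R.
have c0 : 0 < cos (pi / 3 : R) by apply: cos_gt0_pihalf; lra.
have := cos_triple (pi / 3); rewrite (_ : 3 * (pi / 3) = pi); last by field.
rewrite cospi; move: c0; set c := cos _ => c0 e.
have /eqP : (c + 1) * (2 * c - 1) ^+ 2 = 0.
  have -> : (c + 1) * (2 * c - 1) ^+ 2 = 4 * c ^+ 3 - 3 * c + 1 by ring.
  lra.
rewrite mulf_eq0 sqrf_eq0 => /orP[] /eqP; lra.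
Qed.

Lemma sin_pi3_sqr : sin (pi / 3) ^+ 2 = 3 / 4 :> R.
Proof. by rewrite sin2cos2 cos_pi3; field. Qed.

Lemma cos_pi6_sqr : cos (pi / 6) ^+ 2 = 3 / 4 :> R.
Proof.
have := cos_double (pi / 6); rewrite (_ : 2 * (pi / 6) = pi / 3); last by field.
rewrite cos_pi3; lra.
Qed.

Lemma sin_pi6 : sin (pi / 6) = 1 / 2 :> R.
Proof.
have p0 := pi_gt0 R.
have s0 : 0 < sin (pi / 6 : R) by apply: sin_gt0_pihalf; lra.
have : sin (pi / 6 : R) ^+ 2 = 1 / 4 by rewrite sin2cos2 cos_pi6_sqr; field.
nra.
Qed.

Lemma sin_pi4_sqr : sin (pi / 4) ^+ 2 = 1 / 2 :> R.
Proof.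
have := cos_half_sin (pi / 2); rewrite cos_pihalf.
by rewrite (_ : pi / 2 / 2 = pi / 4); [lra | field].
Qed.

Lemma sin_pi12_sqr : sin (pi / 12) ^+ 2 = (1 - cos (pi / 6)) / 2 :> R.
Proof.
have := cos_half_sin (pi / 6).
by rewrite (_ : pi / 6 / 2 = pi / 12); [lra | field].
Qed.

(* Both bounds compare [sin (pi / 12)] with [pi / 12]. *)
Lemma pi_ge_31 : 31 / 10 <= pi :> R.
Proof.
have p0 := pi_gt0 R.
have c0 : 0 < cos (pi / 6 : R) by apply: cos_gt0_pihalf; lra.
have s0 : 0 < sin (pi / 12 : R) by apply: sin_gt0_pihalf; lra.
have := @sin_le (pi / 12); move: s0 c0 cos_pi6_sqr sin_pi12_sqr.
set s := sin _; set c := cos _ => s0 c0 c2 s2 /(_ _)/wrap[|h]; first lra.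
have c1 : c <= 13 / 15 by nra.
have : s ^+ 2 <= (pi / 12) ^+ 2 by nra.
nra.
Qed.

Lemma pi_le_227 : pi <= 22 / 7 :> R.
Proof.
have p0 := pi_gt0 R; have p2 := pihalf_lt2 R.
have c0 : 0 < cos (pi / 6 : R) by apply: cos_gt0_pihalf; lra.
have s0 : 0 < sin (pi / 12 : R) by apply: sin_gt0_pihalf; lra.
have := @sin_ge_cubic (pi / 12); move: s0 c0 cos_pi6_sqr sin_pi12_sqr.
set s := sin _; set c := cos _ => s0 c0 c2 s2 /(_ _)/wrap[|h]; first lra.
have c1 : 866 / 1000 <= c by nra.
have s1 : s <= 2589 / 10000 by nra.
rewrite leNgt; apply/negP => pp; clear s0 c0 c2 s2 c1 p0.
have x1 : 11 / 42 < pi / 12 :> R by lra.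
have x2 : pi / 12 < 1 / 3 :> R by lra.
move: h x1 x2; set x : R := pi / 12 => h x1 x2.
(* Here 11/42 is 22/7 divided by 12. The value of [y - y ^+ 3 / 6] there already exceeds the bound
   [s1] on the sine, and it grows up to [x]. *)
have : (x - 11 / 42) * (1 - (x ^+ 2 + x * (11 / 42) + (11 / 42) ^+ 2) / 6)
  = (x - x ^+ 3 / 6) - (11 / 42 - (11 / 42) ^+ 3 / 6) by field.
have : 0 < (x - 11 / 42) * (1 - (x ^+ 2 + x * (11 / 42) + (11 / 42) ^+ 2) / 6).
  clear h s1; have xx : x ^+ 2 < 1 by nra.
  by apply: mulr_gt0; lra.
clear x1 x2 p2 pp; lra.
Qed.

(** This and the next four bounds are for the angles [k * (7 * pi) / 24] with [k] = 4, 6, 12, 8, 24: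
    the three frequencies used below and their doubles. *)
Lemma sin_7pi6 : sin (7 * pi / 6) = - (1 / 2) :> R.
Proof.
rewrite (_ : 7 * pi / 6 = pi / 6 + pi); last by field.
by rewrite sinDpi sin_pi6.
Qed.

Lemma sin_7pi4_le : sin (7 * pi / 4) <= - (707 / 1000) :> R.
Proof.
rewrite (_ : 7 * pi / 4 = - (pi / 4) + pi *+ 2); last by rewrite mulr2n; field.
rewrite sinD2pi sinN; have p0 := pi_gt0 R.
have : 0 < sin (pi / 4 : R) by apply: sin_gt0_pihalf; lra.
have := sin_pi4_sqr; nra.
Qed.

Lemma sin_7pi2 : sin (7 * pi / 2) = - 1 :> R.
Proof.
rewrite (_ : 7 * pi / 2 = pi / 2 + pi + pi *+ 2); last by rewrite mulr2n; field.
by rewrite sinD2pi sinDpi sin_pihalf.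
Qed.

Lemma norm_sin_7pi3_le : `|sin (7 * pi / 3)| <= 13 / 15 :> R.
Proof.
rewrite (_ : 7 * pi / 3 = pi / 3 + pi *+ 2); last by rewrite mulr2n; field.
rewrite sinD2pi ler_norml; have := sin_pi3_sqr; nra.
Qed.

Lemma sin_7pi : sin (7 * pi) = 0 :> R.
Proof.
rewrite (_ : 7 * pi = pi + pi *+ 2 + pi *+ 2 + pi *+ 2); last by rewrite mulr2n; ring.
by rewrite !sinD2pi sinpi.
Qed.

(* Three doublings of [1 - x ^+ 2 / 2 <= cos x]. *)
Lemma cos_ge_of_le x (y l : R) : 0 <= x <= y -> y <= 2 ->
  l <= 1 - (y / 8) ^+ 2 / 2 ->
  0 <= l -> 0 <= 2 * l ^+ 2 - 1 -> 0 <= 2 * (2 * l ^+ 2 - 1) ^+ 2 - 1 ->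
  2 * (2 * (2 * l ^+ 2 - 1) ^+ 2 - 1) ^+ 2 - 1 <= cos x.
Proof.
move=> /andP[x0 xy] y2 ly l0 l1 l2.
have p2 := pi_ge2 R.
have c8 : l <= cos (x / 8).
  apply: (le_trans ly); apply: le_trans (cos_ge_quadratic _); last by lra.
  nra.
have c4 : 2 * l ^+ 2 - 1 <= cos (x / 4).
  by rewrite (_ : x / 4 = 2 * (x / 8)); [rewrite cos_double; nra | field].
have c2 : 2 * (2 * l ^+ 2 - 1) ^+ 2 - 1 <= cos (x / 2).
  rewrite (_ : x / 2 = 2 * (x / 4)); last by field.
  by rewrite cos_double; move: c4 l1; set u := _ - 1; set v := cos _ => *; nra.
rewrite (_ : x = 2 * (x / 2)); last by field.
by rewrite cos_double; move: c2 l2; set u := _ - 1; set v := cos _ => *; nra.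
Qed.

(** 459/500 bounds the phase of a label up to [T / 2], see [test_poly_phase_ge1]. *)
Lemma cos_ge_inner x : `|x| <= 459 / 500 -> 607 / 1000 <= cos x.
Proof.
move=> xb; rewrite -cos_norm.
have l1 : 0 <= 1 - (459 / 500 / 8) ^+ 2 / 2 :> R by lra.
have l2 : 0 <= 2 * (1 - (459 / 500 / 8) ^+ 2 / 2) ^+ 2 - 1 :> R by lra.
have l3 : 0 <= 2 * (2 * (1 - (459 / 500 / 8) ^+ 2 / 2) ^+ 2 - 1) ^+ 2 - 1 :> R by lra.
have := cos_ge_of_le _ _ (lexx _) l1 l2 l3.
move=> /(_ `|x|); rewrite normr_ge0 xb => /(_ isT _)/wrap[|h]; first lra.
apply: le_trans h; lra.
Qed.

(** 1173/1000 bounds the phase of a label up to [T / 2 + 3 m / 2], see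
    [test_poly_phase_ge_outer]. *)
Lemma cos_ge_outer x : `|x| <= 1173 / 1000 -> 193 / 500 <= cos x.
Proof.
move=> xb; rewrite -cos_norm.
have l1 : 0 <= 1 - (1173 / 1000 / 8) ^+ 2 / 2 :> R by lra.
have l2 : 0 <= 2 * (1 - (1173 / 1000 / 8) ^+ 2 / 2) ^+ 2 - 1 :> R by lra.
have l3 : 0 <= 2 * (2 * (1 - (1173 / 1000 / 8) ^+ 2 / 2) ^+ 2 - 1) ^+ 2 - 1 :> R by lra.
have := cos_ge_of_le _ _ (lexx _) l1 l2 l3.
move=> /(_ `|x|); rewrite normr_ge0 xb => /(_ isT _)/wrap[|h]; first lra.
apply: le_trans h; lra.
Qed.

End TrigBounds.

(** * A test polynomial in the cosine *)

Section TestPolynomial.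
Variable R : realFieldType.
Local Open Scope ring_scope.
Implicit Types a b x : R.

(* [test_poly (cos b)] is [251/100 cos 2b - 331/200 cos 3b + 9/50 cos 6b]. The
   coefficients minimise, up to rounding, the bound of [sum_test_poly_le] among
   those satisfying [test_poly_ge1]. *)
Definition test_poly x : R :=
  251 / 100 * (2 * x ^+ 2 - 1) - 331 / 200 * (4 * x ^+ 3 - 3 * x)
  + 9 / 50 * (2 * (4 * x ^+ 3 - 3 * x) ^+ 2 - 1).

(** The exponents add up to 6, the degree of [test_poly]. *)
Lemma bernstein_basis_ge0 a b x : a <= x <= b ->
  [/\ 0 <= (b - x) ^+ 6, 0 <= (x - a) * (b - x) ^+ 5,
      0 <= (x - a) ^+ 2 * (b - x) ^+ 4, 0 <= (x - a) ^+ 3 * (b - x) ^+ 3 &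
      [/\ 0 <= (x - a) ^+ 4 * (b - x) ^+ 2, 0 <= (x - a) ^+ 5 * (b - x) &
          0 <= (x - a) ^+ 6]].
Proof.
by move=> /andP[ax xb]; split; [..|split]; rewrite ?mulr_ge0 ?exprn_ge0 ?subr_ge0.
Qed.

(* The coefficients of [test_poly - 1], resp. [test_poly + 1 / 10], in the
   Bernstein basis of each of the intervals are positive. *)
Lemma test_poly_ge1 x : 607 / 1000 <= x <= 1 -> 1 <= test_poly x.
Proof.
rewrite /test_poly => /andP[x0 x1].
have [x2|/ltW x2] := leP x (4 / 5).
  have /bernstein_basis_ge0[] : 607 / 1000 <= x <= 4 / 5 by rewrite x0.
  by move=> + + + + []; lra.
have [x3|/ltW x3] := leP x (19 / 20).
  have /bernstein_basis_ge0[] : 4 / 5 <= x <= 19 / 20 by rewrite x2.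
  by move=> + + + + []; lra.
have /bernstein_basis_ge0[] : 19 / 20 <= x <= 1 by rewrite x3.
by move=> + + + + []; lra.
Qed.

Lemma test_poly_ge_outer x : 193 / 500 <= x <= 1 -> - (1 / 10) <= test_poly x.
Proof.
move=> /andP[x0 x1]; have [x2|/ltW x2] := leP x (607 / 1000); last first.
  by have := @test_poly_ge1 x; rewrite x2 x1 => /(_ isT); lra.
have /bernstein_basis_ge0[] : 193 / 500 <= x <= 607 / 1000 by rewrite x0.
by rewrite /test_poly; move=> + + + + []; lra.
Qed.

End TestPolynomial.

(** * Exponential sums *)

Section ExponentialSums.
Variables (R : realType) (I : finType) (J : {set I}) (adj : rel I).
Variables (g : I -> nat) (T : nat).
Local Open Scope ring_scope.
Implicit Types th : R.

Hypothesis far_range :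
  forall u, u \in far_pairs J adj -> (0 < g u.1 + g u.2 <= T)%N.
Hypothesis far_inj : {in far_pairs J adj &, forall u v,
  (g u.1 + g u.2 = g v.1 + g v.2)%N -> v = u \/ v = (u.2, u.1)}.

(** Half the mean of 1, ..., T: shifted by twice this, these numbers are symmetric about 0, which
    makes the kernel real. *)
Definition center : R := (T%:R + 1) / 4.
Definition cos_sum th := \sum_(x in J) cos (th * ((g x)%:R - center)).
Definition sin_sum th := \sum_(x in J) sin (th * ((g x)%:R - center)).
Definition dirichlet th :=
  \sum_(1 <= w < T.+1) cos (th * (w%:R - 2 * center)).
(** The factor of [r] in [sum_pairs_deviation]. *)
Definition defect : R :=
  2 * T%:R - #|J|%:R * (#|J|%:R - 1) + 2 * #|near_pairs J adj|%:R.

Lemma defect_ge0 : 0 <= defect.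
Proof.
have one1 (w : nat) : `|1 : R| <= 1 by rewrite normr1.
have := sum_pairs_deviation far_range far_inj one1.
by rewrite mulr1; apply: le_trans.
Qed.

(** The product telescopes, and by the choice of [center] the two boundary terms are opposite. *)
Lemma sin_dirichlet th : sin (th / 2) * dirichlet th = sin (th * T%:R / 2).
Proof.
pose u (w : nat) := sin (th * (w%:R - 1 / 2 - 2 * center)).
have e : 2 * sin (th / 2) * dirichlet th = u T.+1 - u 1%N.
  rewrite mulr_sumr -(telescope_sumr u) //; apply: eq_bigr => w _.
  rewrite /u (_ : th * (w.+1%:R - 1 / 2 - 2 * center) =
    th * (w%:R - 2 * center) + th / 2); last by rewrite -natr1; field.
  rewrite (_ : th * (w%:R - 1 / 2 - 2 * center) =
    th * (w%:R - 2 * center) - th / 2); last by field.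
  by rewrite sinD sinB; ring.
have : 2 * (sin (th / 2) * dirichlet th) = 2 * sin (th * T%:R / 2).
  rewrite mulrA e /u /center.
  rewrite (_ : th * (T.+1%:R - 1 / 2 - 2 * ((T%:R + 1) / 4)) = th * T%:R / 2).
    rewrite (_ : th * (1 - 1 / 2 - 2 * ((T%:R + 1) / 4)) = - (th * T%:R / 2)).
      by rewrite sinN; ring.
    by field.
  by rewrite -natr1; field.
lra.
Qed.

Lemma sum_sin_dirichlet th : sin (th / 2) != 0 ->
  \sum_(1 <= w < T.+1) sin (th * (w%:R - 2 * center)) = 0.
Proof.
move=> s0; pose u (w : nat) := cos (th * (w%:R - 1 / 2 - 2 * center)).
have e : 2 * sin (th / 2) * \sum_(1 <= w < T.+1) sin (th * (w%:R - 2 * center))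
    = - (u T.+1 - u 1%N).
  rewrite mulr_sumr -(telescope_sumr u) // -sumrN; apply: eq_bigr => w _.
  rewrite /u (_ : th * (w.+1%:R - 1 / 2 - 2 * center) =
    th * (w%:R - 2 * center) + th / 2); last by rewrite -natr1; field.
  rewrite (_ : th * (w%:R - 1 / 2 - 2 * center) =
    th * (w%:R - 2 * center) - th / 2); last by field.
  by rewrite cosD cosB; ring.
apply/eqP; move/eqP: e; rewrite /u /center.
rewrite (_ : th * (T.+1%:R - 1 / 2 - 2 * ((T%:R + 1) / 4)) = th * T%:R / 2).
  rewrite (_ : th * (1 - 1 / 2 - 2 * ((T%:R + 1) / 4)) = - (th * T%:R / 2)).
    rewrite cosN subrr oppr0 mulf_eq0 => /orP[|//].
    by rewrite mulf_eq0 (negPf s0) orbF pnatr_eq0.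
  by field.
by rewrite -natr1; field.
Qed.

Lemma linear_cos_sin_le (p q rho y : R) : 0 <= rho -> rho ^+ 2 = p ^+ 2 + q ^+ 2 ->
  `|p * cos y + q * sin y| <= rho.
Proof.
move=> rho0 e; rewrite -(@ler_pXn2r _ 2) ?nnegrE // real_normK ?num_real // e.
have := cos2Dsin2 y; set c := cos y; set s := sin y => h.
have -> : p ^+ 2 + q ^+ 2 = (p ^+ 2 + q ^+ 2) * (c ^+ 2 + s ^+ 2) by rewrite h mulr1.
have : 0 <= (p * s - q * c) ^+ 2 by exact: sqr_ge0.
lra.
Qed.

(** Both sides are the real part of [(p - i q) z ^+ 2] with [z = cos_sum th + i sin_sum th]. *)
Lemma sum_pairs_cos_sin th (p q : R) :
  \sum_(x in J) \sum_(y in J)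
    (p * cos (th * ((g x + g y)%:R - 2 * center))
     + q * sin (th * ((g x + g y)%:R - 2 * center)))
  = p * (cos_sum th ^+ 2 - sin_sum th ^+ 2) + q * (2 * cos_sum th * sin_sum th).
Proof.
pose c x := cos (th * ((g x)%:R - center)).
pose s x := sin (th * ((g x)%:R - center)).
transitivity (\sum_(x in J) \sum_(y in J)
  (p * (c x * c y) - p * (s x * s y) + q * (s x * c y) + q * (c x * s y))).
  apply: eq_bigr => x _; apply: eq_bigr => y _.
  rewrite (_ : th * ((g x + g y)%:R - 2 * center) =
    th * ((g x)%:R - center) + th * ((g y)%:R - center)); last by rewrite natrD; ring.
  by rewrite cosD sinD -/(c x) -/(c y) -/(s x) -/(s y); ring.
have dbl (a b : I -> R) (k : R) :
    \sum_(x in J) \sum_(y in J) k * (a x * b y)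
    = k * ((\sum_(x in J) a x) * (\sum_(y in J) b y)).
  rewrite mulr_suml mulr_sumr; apply: eq_bigr => x _.
  by rewrite mulr_sumr mulr_sumr.
have -> : \sum_(x in J) \sum_(y in J)
    (p * (c x * c y) - p * (s x * s y) + q * (s x * c y) + q * (c x * s y))
  = \sum_(x in J) \sum_(y in J) p * (c x * c y)
    + \sum_(x in J) \sum_(y in J) (- p) * (s x * s y)
    + \sum_(x in J) \sum_(y in J) q * (s x * c y)
    + \sum_(x in J) \sum_(y in J) q * (c x * s y).
  rewrite -!big_split /=; apply: eq_bigr => x _.
  by rewrite -!big_split /=; apply: eq_bigr => y _; ring.
by rewrite !dbl /cos_sum /sin_sum -/(c _) -/(s _); ring.
Qed.

(** This is [sum_pairs_deviation] for the component of the exponential in the direction [(p, q)];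
    the diagonal becomes the exponential sum at [2 * th]. *)
Lemma exp_sum_sqr_le th (p q rho : R) : sin (th / 2) != 0 ->
    0 <= rho -> rho ^+ 2 = p ^+ 2 + q ^+ 2 ->
  p * (cos_sum th ^+ 2 - sin_sum th ^+ 2) + q * (2 * cos_sum th * sin_sum th)
    - 2 * p * dirichlet th
  <= defect * rho + (p * cos_sum (2 * th) + q * sin_sum (2 * th)).
Proof.
move=> s0 rho0 e.
pose H (w : nat) : R := p * cos (th * (w%:R - 2 * center)) + q * sin (th * (w%:R - 2 * center)).
have := sum_pairs_deviation far_range far_inj (fun w => linear_cos_sin_le _ rho0 e : `|H w| <= rho).
rewrite sum_pairs_cos_sin big_split /= -!mulr_sumr sum_sin_dirichlet // -/(dirichlet th).
have -> : \sum_(x in J) H (g x + g x)%N = p * cos_sum (2 * th) + q * sin_sum (2 * th).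
  rewrite !mulr_sumr -big_split /=; apply: eq_bigr => x _; rewrite /H natrD.
  by congr (p * cos _ + q * sin _); ring.
rewrite ler_norml /defect => /andP[_]; lra.
Qed.

(** Take the direction of [z ^+ 2] in [exp_sum_sqr_le], bound the sum at [2 * th] trivially by
    [#|J|], and divide by the squared modulus of [z]. *)
Lemma exp_sum_modulus th : sin (th / 2) != 0 ->
  cos_sum th ^+ 2 + sin_sum th ^+ 2 <= 2 * `|dirichlet th| + defect + #|J|%:R.
Proof.
move=> s0; set A := cos_sum th; set S := sin_sum th.
have [->|r0] := eqVneq (A ^+ 2 + S ^+ 2) 0.
  have := defect_ge0; have := normr_ge0 (dirichlet th); have := ler0n R #|J|; lra.
have rp : 0 < A ^+ 2 + S ^+ 2 by rewrite lt_neqAle eq_sym r0 addr_ge0 ?sqr_ge0.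
have e : (A ^+ 2 + S ^+ 2) ^+ 2 = (A ^+ 2 - S ^+ 2) ^+ 2 + (2 * A * S) ^+ 2 by ring.
have := exp_sum_sqr_le s0 (ltW rp) e; rewrite -/A -/S.
set p := A ^+ 2 - S ^+ 2; set q := 2 * A * S.
have d : p * cos_sum (2 * th) + q * sin_sum (2 * th) <= #|J|%:R * (A ^+ 2 + S ^+ 2).
  rewrite !mulr_sumr -big_split /= (mulr_natl (_ ^+ 2 + _)) -sumr_const; apply: ler_sum => x _.
  by apply: le_trans (linear_cos_sin_le _ (ltW rp) e); exact: ler_norm.
have pD : 2 * p * dirichlet th <= 2 * `|dirichlet th| * (A ^+ 2 + S ^+ 2).
  have : p * dirichlet th <= `|dirichlet th| * (A ^+ 2 + S ^+ 2).
    apply: le_trans (ler_norm _) _; rewrite normrM mulrC ler_wpM2l //.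
    by rewrite ler_norml /p; have := sqr_ge0 A; have := sqr_ge0 S; lra.
  lra.
move=> h; rewrite -(ler_pM2r rp).
have : (A ^+ 2 + S ^+ 2) * (A ^+ 2 + S ^+ 2) = p * p + q * q by rewrite /p /q; ring.
move: h d pD; set D2 := _ * dirichlet th; lra.
Qed.

(* With [z = A + i S], the vector [z ^+ 2 - 2 D] has modulus at most [E];
   since [|z ^+ 2 + B| ^+ 2 = (|z| ^+ 2 - B) ^+ 2 + 4 * A ^+ 2 * B], a negative
   [D] forces the real part of [z] to be small. *)
Lemma cos_sum_sqr_le th (r2 B : R) : sin (th / 2) != 0 ->
    0 <= r2 -> cos_sum (2 * th) ^+ 2 + sin_sum (2 * th) ^+ 2 <= r2 ^+ 2 ->
    0 <= B -> B <= - (2 * dirichlet th) ->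
  4 * cos_sum th ^+ 2 * B <= (defect + r2) ^+ 2.
Proof.
move=> s0 r20 r2P B0 BD; set A := cos_sum th; set S := sin_sum th.
pose r := Num.sqrt (A ^+ 2 + S ^+ 2).
have rE : r ^+ 2 = A ^+ 2 + S ^+ 2 by rewrite sqr_sqrtr // addr_ge0 ?sqr_ge0.
have r0 : 0 <= r by exact: sqrtr_ge0.
have diag (p q : R) : r ^+ 2 = p ^+ 2 + q ^+ 2 ->
    p * cos_sum (2 * th) + q * sin_sum (2 * th) <= r2 * r.
  move=> e; apply: le_trans (ler_norm _) _.
  rewrite -(@ler_pXn2r _ 2) ?nnegrE ?mulr_ge0 // real_normK ?num_real // exprMn e.
  set u := cos_sum _ in r2P *; set v := sin_sum _ in r2P *.
  apply: (@le_trans _ _ ((u ^+ 2 + v ^+ 2) * (p ^+ 2 + q ^+ 2))).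
    have : 0 <= (p * v - q * u) ^+ 2 by exact: sqr_ge0.
    lra.
  by rewrite ler_wpM2r // addr_ge0 ?sqr_ge0.
(* Now the direction is that of [z], or of [- z] if [A] is negative: the real part of the conjugate
   of [z] times [z ^+ 2] is [A * r ^+ 2]. *)
have key : `|A| * (r ^+ 2 + B) <= (defect + r2) * r.
  rewrite rE; have [A0|A0] := leP 0 A; [rewrite ger0_norm // | rewrite ltr0_norm //].
    have := exp_sum_sqr_le s0 r0 rE; have := diag _ _ rE; rewrite -/A -/S.
    have : A * B <= A * - (2 * dirichlet th) by exact: ler_wpM2l.
    have -> : A * (A ^+ 2 - S ^+ 2) + S * (2 * A * S) = A * (A ^+ 2 + S ^+ 2) by ring.
    lra.
  have rN : r ^+ 2 = (- A) ^+ 2 + (- S) ^+ 2 by rewrite !sqrrN.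
  have := exp_sum_sqr_le s0 r0 rN; have := diag _ _ rN; rewrite -/A -/S.
  have : - A * B <= - A * - (2 * dirichlet th) by apply: ler_wpM2l => //; lra.
  have -> : - A * (A ^+ 2 - S ^+ 2) + - S * (2 * A * S) = - A * (A ^+ 2 + S ^+ 2) by ring.
  lra.
have [r00|rn0] := eqVneq r 0.
  have -> : A ^+ 2 = 0.
    by apply/eqP; rewrite eq_le sqr_ge0 andbT; have := sqr_ge0 S; move: rE; rewrite r00; lra.
  by rewrite mulr0 mul0r sqr_ge0.
have rp : 0 < r ^+ 2 by rewrite exprn_gt0 // lt_neqAle eq_sym rn0.
rewrite -(ler_pM2r rp) -exprMn.
have : (`|A| * (r ^+ 2 + B)) ^+ 2 <= ((defect + r2) * r) ^+ 2.
  by rewrite ler_sqr ?nnegrE // ?(le_trans _ key) // mulr_ge0 // addr_ge0 // sqr_ge0.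
apply: le_trans; rewrite exprMn real_normK ?num_real //.
(* This gives [4 * r ^+ 2 * B <= (r ^+ 2 + B) ^+ 2], multiplied by [A ^+ 2]. *)
have : 0 <= A ^+ 2 * (r ^+ 2 - B) ^+ 2 by rewrite mulr_ge0 ?sqr_ge0.
lra.
Qed.

End ExponentialSums.

(** * The test polynomial summed over the labels *)

Section TestSum.
Variables (R : realType) (I : finType) (J : {set I}) (adj : rel I).
Variables (g : I -> nat) (T : nat).
Local Open Scope ring_scope.

Hypothesis far_range :
  forall u, u \in far_pairs J adj -> (0 < g u.1 + g u.2 <= T)%N.
Hypothesis far_inj : {in far_pairs J adj &, forall u v,
  (g u.1 + g u.2 = g v.1 + g v.2)%N -> v = u \/ v = (u.2, u.1)}.
Hypothesis T_ge : (20 * 37 <= T)%N.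

(* The three frequencies [4 tau], [6 tau], [12 tau] are [2 pi u / T] for
   [u = 7/6, 7/4, 7/2], where the Dirichlet kernel is negative. *)
Definition tau : R := 7 * pi / (12 * T%:R).

Let T740 : 20 * 37 <= T%:R :> R. Proof. by rewrite -natrM ler_nat. Qed.

Let T_neq0 : T%:R != 0 :> R. Proof. by rewrite gt_eqF //; have := T740; lra. Qed.

Let tau_mul : tau * T%:R = 7 / 12 * pi.
Proof. by rewrite /tau; field. Qed.

Lemma tau_le : tau * T%:R <= 11 / 6.
Proof. by rewrite tau_mul; have := pi_le_227 R; lra. Qed.

Lemma tau_ge : 217 / 120 <= tau * T%:R.
Proof. by rewrite tau_mul; have := pi_ge_31 R; lra. Qed.

Lemma tau_small : 0 < tau /\ 12 * tau <= 1 / 30.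
Proof.
have h1 := tau_le; have h2 := tau_ge; have h3 := T740; split.
  by rewrite -(@pmulr_lgt0 _ T%:R); lra.
rewrite -(@ler_pM2r _ T%:R); lra.
Qed.

Lemma sin_small (x : R) : 0 < x <= 12 * tau -> 999 / 1000 * x <= sin x <= x.
Proof.
move=> /andP[x0 x1]; have [_ t1] := tau_small; have p2 := pi_ge2 R.
rewrite sin_le ?(ltW x0) // andbT; apply: le_trans (sin_ge_cubic _); last lra.
have : x ^+ 2 * x <= 6 / 1000 * x by rewrite ler_pM2r //; nra.
rewrite -exprSr; lra.
Qed.

Lemma dirichlet_ge th (s : R) : 0 < th / 2 <= 12 * tau ->
    sin (th * T%:R / 2) <= - s -> 0 <= s ->
  s * 2 <= - (2 * dirichlet T th) * (th / 2).
Proof.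
move=> tb sP s0; have /andP[_ h] := sin_small tb; have /andP[t0 _] := tb.
have sp : 0 < sin (th / 2) by apply: lt_le_trans (andP (sin_small tb)).1; lra.
move: sP; rewrite -sin_dirichlet => e.
have D0 : dirichlet T th <= 0.
  by rewrite -(ler_pM2l sp) mulr0; lra.
have : - dirichlet T th * sin (th / 2) <= - dirichlet T th * (th / 2).
  by rewrite ler_wpM2l //; lra.
lra.
Qed.

Lemma dirichlet_norm th (s : R) : 0 < th / 2 <= 12 * tau ->
    `|sin (th * T%:R / 2)| <= s ->
  `|dirichlet T th| * (999 / 1000 * (th / 2)) <= s.
Proof.
move=> tb; have /andP[h _] := sin_small tb; have /andP[t0 _] := tb.
rewrite -sin_dirichlet normrM => e; apply: le_trans e; rewrite mulrC.
rewrite ler_wpM2r //; apply: le_trans (ler_norm _); lra.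
Qed.

Let ang (k : R) : k * tau * T%:R / 2 = k * (7 * pi) / 24.
Proof. by rewrite -(mulrA k) tau_mul; field. Qed.

Lemma sin_freq_neq0 (k : R) : 0 < k <= 24 -> sin (k * tau / 2) != 0.
Proof.
move=> /andP[k0 k24]; have [t0 _] := tau_small.
have tb : 0 < k * tau / 2 <= 12 * tau by nra.
by rewrite gt_eqF //; apply: lt_le_trans (andP (sin_small tb)).1; nra.
Qed.

(** These are the doubled frequencies; the constant 6/25 is dictated by [k = 8]. *)
Lemma dirichlet_harmonic (k : R) : k = 8 \/ k = 12 \/ k = 24 ->
  2 * `|dirichlet T (k * tau)| <= 6 / 25 * T%:R.
Proof.
move=> kE; have [t0 _] := tau_small; have tT := tau_ge.
have norm (j s : R) : 0 < j <= 24 -> `|sin (j * (7 * pi) / 24)| <= s ->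
    s <= 3 / 25 * (999 / 1000) * (j / 2) * (217 / 120) ->
    2 * `|dirichlet T (j * tau)| <= 6 / 25 * T%:R.
  move=> /andP[j0 j24]; rewrite -ang => sP sj.
  have tb : 0 < j * tau / 2 <= 12 * tau by nra.
  have := dirichlet_norm tb sP; set d := `|_| => h.
  have jt : 0 < j * tau by rewrite mulr_gt0.
  have : d * (j * tau) <= 3 / 25 * T%:R * (j * tau).
    have : 3 / 25 * (999 / 1000) * (j / 2) * (217 / 120)
        <= 3 / 25 * (999 / 1000) * (j / 2) * (tau * T%:R).
      by rewrite ler_wpM2l //; lra.
    lra.
  by rewrite ler_pM2r //; lra.
case: kE => [->|[]->].
- apply: (@norm _ (13 / 15)); [by lra| |by lra].
  by rewrite (_ : 8 * (7 * pi) / 24 = 7 * pi / 3) ?norm_sin_7pi3_le //; field.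
- apply: (@norm _ 1); [by lra|exact: sin_max|by lra].
- apply: (@norm _ 0); [by lra| |by lra].
  by rewrite (_ : 24 * (7 * pi) / 24 = 7 * pi) ?sin_7pi ?normr0 //; field.
Qed.

Variable r2 : R.
Hypothesis r2_ge0 : 0 <= r2.
Hypothesis r2P : 6 / 25 * T%:R + defect R J adj T + #|J|%:R <= r2 ^+ 2.

(** The common scale of the bounds on the three real parts. By [r2P], [exp_sum_modulus] and
    [dirichlet_harmonic], [r2] bounds the modulus of the sum at the doubled frequencies. *)
Definition amplitude : R := (defect R J adj T + r2) / Num.sqrt T%:R.

Lemma amplitude_ge0 : 0 <= amplitude.
Proof. by rewrite divr_ge0 ?sqrtr_ge0 // addr_ge0 ?(defect_ge0 _ far_range far_inj). Qed.

(** In [cos_sum_sqr_le], [dirichlet_ge] allows [B = 4 s / (k tau)]. The condition on [b] is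
    [k * tau * T <= 16 * s * b ^+ 2] with [tau * T] replaced by its bound 11/6. *)
Lemma cos_sum_le (k s b : R) : k = 4 \/ k = 6 \/ k = 12 ->
    sin (k * (7 * pi) / 24) <= - s -> 0 <= s ->
    k * 11 <= 96 * s * b ^+ 2 -> 0 <= b ->
  `|cos_sum J g T (k * tau)| <= b * amplitude.
Proof.
move=> kE; rewrite -ang => sP s0 sb b0; have [t0 _] := tau_small.
have k24 : 0 < k <= 12 by case: kE => [->|[]->]; lra.
have /andP[k0 k12] := k24.
have tb : 0 < k * tau / 2 <= 12 * tau by nra.
have D2 := dirichlet_ge tb sP s0.
have sn0 : sin (k * tau / 2) != 0 by apply: sin_freq_neq0; lra.
have sn1 : sin (2 * (k * tau) / 2) != 0.
  by rewrite mulrA; apply: sin_freq_neq0; lra.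
have harm : cos_sum J g T (2 * (k * tau)) ^+ 2 + sin_sum J g T (2 * (k * tau)) ^+ 2 <= r2 ^+ 2.
  apply: le_trans r2P; apply: le_trans (exp_sum_modulus far_range far_inj sn1) _.
  rewrite 2!lerD2r mulrA; apply: dirichlet_harmonic.
  by case: kE => [->|[]->]; [left|right;left|right;right]; ring.
have k2 : 0 < k * tau / 2 by lra.
pose B := 2 * s / (k * tau / 2).
have B0 : 0 <= B by apply: divr_ge0; lra.
have BD : B <= - (2 * dirichlet T (k * tau)).
  by rewrite /B ler_pdivrMr //; lra.
have := cos_sum_sqr_le far_range far_inj sn0 r2_ge0 harm B0 BD.
set A := cos_sum _ _ _ _; set E := _ + r2 => AE.
have T0 : 0 < T%:R :> R by have := T740; lra.
have X2 : amplitude ^+ 2 * T%:R = E ^+ 2.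
  by rewrite /amplitude -/E expr_div_n sqr_sqrtr ?(ltW T0) // divfK // gt_eqF.
have bX : 0 <= b * amplitude by rewrite mulr_ge0 // amplitude_ge0.
rewrite -(@ler_pXn2r _ 2) ?nnegrE // real_normK ?num_real //.
rewrite exprMn -(ler_pM2r T0) -[leRHS]mulrA X2.
apply: le_trans (ler_wpM2l (sqr_ge0 b) AE).
have -> : b ^+ 2 * (4 * A ^+ 2 * B) = A ^+ 2 * (b ^+ 2 * 4 * B) by ring.
rewrite ler_wpM2l ?sqr_ge0 // /B.
rewrite (_ : b ^+ 2 * 4 * (2 * s / (k * tau / 2)) = 16 * s * b ^+ 2 / (k * tau)); last first.
  by field; rewrite !gt_eqF.
have kt : 0 < k * tau by lra.
rewrite ler_pdivlMr //; have := tau_le; rewrite -(ler_pM2l k0); lra.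
Qed.

(** Its multiples by 2, 3 and 6, which occur in [test_poly], belong to the frequencies [4 tau],
    [6 tau] and [12 tau]. *)
Definition phase (x : I) : R := 2 * tau * ((g x)%:R - center R T).

Lemma sum_test_poly_le :
  \sum_(x in J) test_poly (cos (phase x)) <= 17 / 4 * amplitude.
Proof.
have -> : \sum_(x in J) test_poly (cos (phase x))
   = 251 / 100 * cos_sum J g T (4 * tau) - 331 / 200 * cos_sum J g T (6 * tau)
     + 9 / 50 * cos_sum J g T (12 * tau).
  rewrite /cos_sum !mulr_sumr -sumrB -big_split /=; apply: eq_bigr => x _.
  rewrite /test_poly -cos_triple -!cos_double /phase.
  congr (_ * cos _ - _ * cos _ + _ * cos _); ring.
have a0 := amplitude_ge0.
(* 45/47, 79/80 and 47/40 slightly exceed the least [b] allowed by [cos_sum_le]; weighted with the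
   coefficients of [test_poly] they give less than 17/4. *)
have h1 : `|cos_sum J g T (4 * tau)| <= 45 / 47 * amplitude.
  apply: (@cos_sum_le _ (1 / 2)); [by left| |by lra..].
  by rewrite (_ : 4 * (7 * pi) / 24 = 7 * pi / 6) ?sin_7pi6 //; field.
have h2 : `|cos_sum J g T (6 * tau)| <= 79 / 80 * amplitude.
  apply: (@cos_sum_le _ (707 / 1000)); [by right; left| |by lra..].
  by rewrite (_ : 6 * (7 * pi) / 24 = 7 * pi / 4) ?sin_7pi4_le //; field.
have h3 : `|cos_sum J g T (12 * tau)| <= 47 / 40 * amplitude.
  apply: (@cos_sum_le _ 1); [by right; right| |by lra..].
  by rewrite (_ : 12 * (7 * pi) / 24 = 7 * pi / 2) ?sin_7pi2 //; field.
move: h1 h2 h3; rewrite !ler_norml => /andP[_ h1] /andP[h2 _] /andP[_ h3].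
lra.
Qed.

(** Such a label is within [(T + 1) / 4] of [center], so its phase is at most
    [tau * (T + 1) / 2]. *)
Lemma test_poly_phase_ge1 x : (2 * g x <= T)%N -> 1 <= test_poly (cos (phase x)).
Proof.
rewrite -(ler_nat R) natrM => gT.
apply: test_poly_ge1; rewrite cos_le1 andbT; apply: cos_ge_inner.
have [t0 _] := tau_small; have := tau_le; have := T740; have := ler0n R (g x) => g0 T7 tT.
have : tau * (20 * 37) <= 11 / 6 by apply: le_trans tT; rewrite ler_pM2l.
have : tau * (2 * (g x)%:R) <= tau * T%:R by rewrite ler_pM2l.
have : 0 <= tau * (g x)%:R by rewrite mulr_ge0 // ltW.
by rewrite ler_norml /phase /center; lra.
Qed.

Lemma test_poly_phase_ge_outer (m : nat) x : (40 <= m)%N -> (m * (m + 3) <= 2 * T)%N ->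
  (2 * g x <= T + 3 * m)%N -> - (1 / 10) <= test_poly (cos (phase x)).
Proof.
move=> m40 mT; rewrite -(ler_nat R) natrM natrD natrM => gT.
apply: test_poly_ge_outer; rewrite cos_le1 andbT; apply: cos_ge_outer.
have [t0 _] := tau_small; have := tau_le; have := T740; have := ler0n R (g x) => g0 T7 tT.
have : tau * (20 * 37) <= 11 / 6 by apply: le_trans tT; rewrite ler_pM2l.
have : tau * (2 * (g x)%:R) <= tau * (T%:R + 3 * m%:R) by rewrite ler_pM2l.
have : 0 <= tau * (g x)%:R by rewrite mulr_ge0 // ltW.
(* As [m] is at least 40, [T] is at least [43 m / 2]. *)
have : tau * m%:R * (43 / 2) <= 11 / 6.
  apply: le_trans tT; rewrite -mulrA ler_pM2l //.
  move: mT m40; rewrite -(ler_nat R) natrM natrD natrM -(ler_nat R); nra.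
by rewrite ler_norml /phase /center; lra.
Qed.

End TestSum.

(** * Contradiction for large wheels *)

Section Contradiction.
Variables (R : realType) (m : nat).
Hypothesis m_ge40 : (40 <= m)%N.
Notation V := (option 'I_m).
Notation rimS := (@ordS m).
Variables (g : V -> nat) (T : nat).
Hypothesis T_eq : (2 * T = m * (m + 3))%N.
Hypothesis far_range :
  forall u, u \in far_pairs [set: V] rim_adj -> (0 < g u.1 + g u.2 <= T)%N.
Hypothesis far_inj : {in far_pairs [set: V] rim_adj &, forall u v,
  (g u.1 + g u.2 = g v.1 + g v.2)%N -> v = u \/ v = (u.2, u.1)}.
Hypothesis g_hub : g None = 0%N.
Local Open Scope ring_scope.

Let m5 : (5 <= m)%N. Proof. lia. Qed.

Let m40 : 40 <= m%:R :> R. Proof. by rewrite (ler_nat _ 40). Qed.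

Let sqr_m : 40 * m%:R <= m%:R ^+ 2 :> R.
Proof. by rewrite expr2 ler_wpM2r. Qed.

Let m_gt65 : 0 <= m%:R - 6 / 5 :> R. Proof. by have := m40; lra. Qed.

Let m_gt2 : 0 <= m%:R - 2 :> R. Proof. by have := m40; lra. Qed.

Let tE : 2 * T%:R = m%:R * (m%:R + 3) :> R.
Proof. by rewrite -natrM T_eq natrM natrD. Qed.

Let big_pair x y : x != y -> ~~ rim_adj x y -> (g x + g y <= T)%N.
Proof.
move=> xy nr; have /far_range/andP[] // : (x, y) \in far_pairs [set: V] rim_adj.
by rewrite !inE /= xy.
Qed.

Lemma sqr_le_of_le_amplitude (t L d E : R) : 0 < t -> 0 <= L -> d <= E ->
  L <= 17 / 4 * (d / Num.sqrt t) -> L ^+ 2 * t <= (17 / 4 * E) ^+ 2.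
Proof.
move=> t0 L0 dE; have s0 : 0 < Num.sqrt t by rewrite sqrtr_gt0.
rewrite mulrA ler_pdivlMr // => h.
rewrite -[in X in X <= _](sqr_sqrtr (ltW t0)) -exprMn.
have Ls : 0 <= L * Num.sqrt t by rewrite mulr_ge0 // ltW.
rewrite ler_sqr ?nnegrE //; lra.
Qed.

(** Two such labels add up to more than [T], so their vertices are adjacent on the rim, and the rim
    has no triangle. *)
Lemma card_large : (#|[set x | (T < 2 * g x)%N]| <= 2)%N.
Proof.
set X := [set x | _].
have clique x y : x \in X -> y \in X -> x != y -> rim_adj x y.
  rewrite !inE => xX yX xy; apply/negPn/negP=> nr.
  by have := big_pair xy nr; lia.
have [->|[[i|] iX]] := set_0Vmem X; [by rewrite cards0| |]; last first.
  by move: iX; rewrite inE g_hub.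
have XE y : y \in X -> y != Some i -> exists2 j, y = Some j & j = rimS i \/ i = rimS j.
  move=> yX yi; have := clique _ _ iX yX; rewrite eq_sym => /(_ yi).
  by case: y yX yi => // j _ _ /orP[]/eqP e; exists j => //; auto.
have [sX|nsX] := boolP (Some (rimS i) \in X).
  apply: leq_trans (_ : #|[set Some i; Some (rimS i)]| <= _)%N; last first.
    by rewrite cards2; case: (_ == _).
  apply/subset_leq_card/subsetP=> y yX; rewrite !inE.
  case: (eqVneq y (Some i)) => //= yi; have [j yE [jS|ij]] := XE _ yX yi.
    by rewrite yE jS.
  rewrite yE in yX yi *; have := clique _ _ sX yX.
  rewrite ij (inj_eq Some_inj) rimSS_neq // => /(_ isT); rewrite /rim_adj.
  have /negPf -> : j != rimS (rimS (rimS j)) by rewrite (@iter_ordS_eq m j 0 3) //; lia.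
  by rewrite (@iter_ordS_eq m j 2 1) //; lia.
have [j0 jE] : exists j0, i = rimS j0 by exists (ord_pred i); rewrite ord_predK.
apply: leq_trans (_ : #|[set Some i; Some j0]| <= _)%N; last by rewrite cards2; case: (_ == _).
apply/subset_leq_card/subsetP=> y yX; rewrite !inE.
case: (eqVneq y (Some i)) => //= yi; have [j yE [jS|ij]] := XE _ yX yi.
  by rewrite yE jS (negPf nsX) in yX.
by rewrite yE -(ordS_inj (etrans (esym ij) jE)).
Qed.

Lemma balanced_labels_absurd : (forall x, (2 * g x <= T + 3 * m)%N) -> False.
Proof.
move=> g_le.
have T740 : (20 * 37 <= T)%N.
  have : (40 * 37 <= m * (m + 3))%N by apply: leq_mul; lia.
  by move: T_eq; lia.
have dE : defect R [set: V] rim_adj T = 6 * m%:R.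
  rewrite /defect tE card_near_pairsT // cardsT card_option card_ord natrM -natr1; ring.
(* [21 / 38 * m] exceeds the square root of [6 / 25 * T + 7 m + 1] from [m = 40] on. *)
have r0 : 0 <= 21 / 38 * m%:R :> R by rewrite mulr_ge0 // divr_ge0.
have r2P : 6 / 25 * T%:R + defect R [set: V] rim_adj T + #|[set: V]|%:R
    <= (21 / 38 * m%:R) ^+ 2 :> R.
  rewrite dE cardsT card_option card_ord -natr1; have := tE; have := m40; have := sqr_m; lra.
have up := sum_test_poly_le far_range far_inj T740 r0 r2P.
have low : m%:R - 6 / 5 <= \sum_(x in [set: V]) test_poly (cos (phase R g T x)).
  (* A label above [T / 2] still contributes at least -1/10, and at most two of the [m + 1] labels
     are that large. *)
  apply: (@le_trans _ _ (\sum_(x in [set: V]) (1 - 11 / 10 * (T < 2 * g x)%N%:R))).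
    rewrite sumrB sumr_const cardsT card_option card_ord -mulr_sumr -natr_sum.
    have -> : (\sum_(x in [set: V]) (T < 2 * g x)%N = #|[set x | (T < 2 * g x)%N]|)%N.
      rewrite -sum1_card big_mkcond [RHS]big_mkcond; apply: eq_bigr => x _.
      by rewrite !inE; case: ltnP.
    have := card_large; rewrite -(ler_nat R) -natr1; lra.
  apply: ler_sum => x _; case: ltnP => [_|gx] /=.
    have := test_poly_phase_ge_outer R T740 m_ge40 _ (g_le x); rewrite T_eq leqnn => /(_ isT); lra.
  have := test_poly_phase_ge1 R T740 gx; lra.
have t0 : 0 < T%:R :> R by rewrite ltr0n; lia.
have := sqr_le_of_le_amplitude t0 m_gt65 (lexx _) (le_trans low up).
rewrite dE; have := tE; have := m40; set M : R := m%:R; set t : R := T%:R.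
move=> M40 tM h.
have : (M - 6 / 5) ^+ 2 * (M * (M + 3)) <= 2 * (17 / 4 * (6 * M + 21 / 38 * M)) ^+ 2.
  by rewrite -tM; lra.
(* In powers of [N], the left side minus the right side has only positive coefficients. *)
have [N N0 ->] : exists2 N, 0 <= N & M = N + 40 by exists (M - 40); [lra | ring].
by have := (exprn_ge0 2 N0, exprn_ge0 3 N0, exprn_ge0 4 N0) => -[[]]; lra.
Qed.

(** Every vertex of [J], that is, other than [i] and its rim neighbours, forms a far pair with [i],
    so its label is below [T / 2 - 3 m / 2]. On [J] all far sums are thus at most [T'], and no label
    exceeds [T' / 2]. *)
Lemma unbalanced_labels_absurd (i : 'I_m) : (T + 3 * m < 2 * g (Some i))%N -> False.
Proof.
move=> gi; pose J := ~: [set x in [:: Some i; Some (rimS i); Some (ord_pred i)]].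
pose T' := (T - 3 * m)%N.
have T'E : (2 * T' = m * (m - 3))%N by rewrite /T'; nia.
have gJ x : x \in J -> (2 * g x <= T')%N.
  rewrite !inE !negb_or => /and3P[xi xs xp].
  have : ~~ rim_adj x (Some i).
    case: x xi xs xp => // j _ xs xp; apply/negP=> /orP[]/eqP e.
      by rewrite e ordSK eqxx in xp.
    by rewrite e eqxx in xs.
  by move/(big_pair xi); rewrite /T'; lia.
have farJ u : u \in far_pairs J rim_adj -> u \in far_pairs [set: V] rim_adj.
  by rewrite !inE => /andP[_].
have rangeJ u : u \in far_pairs J rim_adj -> (0 < g u.1 + g u.2 <= T')%N.
  move=> uJ; have /far_range/andP[-> _] := farJ _ uJ.
  case: u uJ => x y; rewrite inE in_setX /= => /andP[/andP[/gJ h1 /gJ h2] _]; lia.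
have injJ : {in far_pairs J rim_adj &, forall u v,
  (g u.1 + g u.2 = g v.1 + g v.2)%N -> v = u \/ v = (u.2, u.1)}.
  by move=> u v /farJ uJ /farJ vJ; exact: far_inj.
(* Counted from [j], the removed rim vertices are those after 1, 2 and 3 steps. *)
pose j := ord_pred (ord_pred i).
have iE : i = iter 2 rimS j by rewrite /= !ord_predK.
have pE : ord_pred i = iter 1 rimS j by rewrite /= ord_predK.
have cJ : #|J| = (m - 2)%N.
  have := cardsC [set x in [:: Some i; Some (rimS i); Some (ord_pred i)]].
  rewrite -/J card_option card_ord cardsE.
  have /card_uniqP -> : uniq [:: Some i; Some (rimS i); Some (ord_pred i)].
    rewrite /= !inE !(inj_eq Some_inj) pE iE -[rimS (iter 2 _ _)]iterS.
    by rewrite !iter_ordS_eq //; lia.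
  by rewrite /=; lia.
have nJ : (#|near_pairs J rim_adj| <= 2 * (m - 4))%N.
  rewrite near_pairs_arcs // card_arcs // leq_mul2l /=.
  (* [B] holds the starting points of the four rim edges that meet a removed vertex. *)
  set A := [set k | _]; pose B := [set k in [seq iter k rimS j | k <- iota 0 4]].
  have cB : #|B| = 4%N.
    rewrite cardsE; apply/card_uniqP.
    rewrite map_inj_in_uniq ?iota_uniq // => k l; rewrite !mem_iota => /andP[_ k4] /andP[_ l4].
    by move/eqP; rewrite iter_ordS_eq => [/eqP|//|//]; lia.
  have : A \subset ~: B.
    apply/subsetP=> k; rewrite !inE !negb_or !(inj_eq Some_inj) pE iE -!andbA -!iterS.
    case/and5P=> k2 k3 k1 _ /andP[_ s1]; rewrite k1 k2 k3 /= !andbT.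
    by apply: contraNneq s1 => ->.
  move/subset_leq_card => AB; apply: leq_trans AB _.
  by have := cardsC B; rewrite cB card_ord => Bm; rewrite -(leq_add2l 4) Bm; lia.
(* [20 * 37] is [m (m - 3) / 2] at [m = 40]. *)
have T740 : (20 * 37 <= T')%N.
  have : (40 * 37 <= m * (m - 3))%N by apply: leq_mul; lia.
  by move: T'E; lia.
have t'E : 2 * T'%:R = m%:R * (m%:R - 3) :> R.
  by rewrite -natrM T'E natrM natrB //; lia.
have kE : #|J|%:R = m%:R - 2 :> R by rewrite cJ natrB //; lia.
have dE : defect R J rim_adj T' <= 6 * m%:R - 22.
  rewrite /defect t'E kE.
  have : #|near_pairs J rim_adj|%:R <= 2 * (m%:R - 4) :> R.
    by rewrite -[4]/(4%:R) -natrB ?(leq_trans _ m5) // -natrM ler_nat.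
  lra.
have r0 : 0 <= 25 / 48 * m%:R :> R by rewrite mulr_ge0 // divr_ge0.
have r2P : 6 / 25 * T'%:R + defect R J rim_adj T' + #|J|%:R
    <= (25 / 48 * m%:R) ^+ 2 :> R.
  rewrite kE; have := t'E; have := m40; have := sqr_ge0 (m%:R - 40 : R); lra.
have up := sum_test_poly_le rangeJ injJ T740 r0 r2P.
have low : m%:R - 2 <= \sum_(x in J) test_poly (cos (phase R g T' x)).
  rewrite -kE -sumr_const; apply: ler_sum => x xJ.
  exact: (test_poly_phase_ge1 R T740 (gJ _ xJ)).
have t0 : 0 < T'%:R :> R by rewrite ltr0n; lia.
have dE' : defect R J rim_adj T' + 25 / 48 * m%:R <= (6 + 25 / 48) * m%:R - 22 by lra.
have := sqr_le_of_le_amplitude t0 m_gt2 dE' (le_trans low up).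
have := t'E; have := m40; set M : R := m%:R; set t : R := T'%:R.
move=> M40 tM h.
have : (M - 2) ^+ 2 * (M * (M - 3)) <= 2 * (17 / 4 * ((6 + 25 / 48) * M - 22)) ^+ 2.
  by rewrite -tM; lra.
have [N N0 ->] : exists2 N, 0 <= N & M = N + 40 by exists (M - 40); [lra | ring].
by have := (exprn_ge0 2 N0, exprn_ge0 3 N0, exprn_ge0 4 N0) => -[[]]; lra.
Qed.

End Contradiction.

Theorem theorem1p1 (n : nat) (hn : 5 <= n)
  (hL : geodesic_Leech (@wheel n)) : n <= 40.
Proof.
case: n hn hL => // m _ [f hf]; rewrite leqNgt; apply/negP=> m40.
have m5 : 5 <= m by lia.
have T_eq : 2 * (m * (m + 3))./2 = m * (m + 3).
  by rewrite mul2n even_halfK // oddM oddD /=; case: odd.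
(* The upper bound is taken as [T]; it only enlarges the range of the sums. *)
have le_T : t_gp (@wheel m.+1) <= (m * (m + 3))./2 by have := t_gp_le m5; lia.
have range u : u \in far_pairs [set: option 'I_m] rim_adj ->
    0 < spoke_label f u.1 + spoke_label f u.2 <= (m * (m + 3))./2.
  by case/(far_label_range hf)/andP=> -> /leq_trans; apply.
have inj := far_label_inj hf.
have [/existsP[[i|]]|/existsPn h] :=
  boolP [exists x, (m * (m + 3))./2 + 3 * m < 2 * spoke_label f x].
- exact: (@unbalanced_labels_absurd Rdefinitions.R m m40 _ _ T_eq range inj).
- by rewrite muln0.
- apply: (@balanced_labels_absurd Rdefinitions.R m m40 _ _ T_eq range inj) => // x.
  by rewrite leqNgt.
Qed.
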